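(* Let $\mathcal{I}$ be an operator ideal (of bounded linear operators between Banach spaces). Then $$\mathcal{I}^{BLip\text{-}dual}=\mathcal{I}^{dual}\circ BLip_0 .$$ Moreover, if $(\mathcal{I},\|\cdot\|_{\mathcal{I}})$ is a normed operator ideal, then $\|\cdot\|_{\mathcal{I}^{BLip\text{-}dual}}=\|\cdot\|_{\mathcal{I}^{dual}\circ BLip_0}$.
   Context: Let $\mathbb{K}$ be $\mathbb{R}$ or $\mathbb{C}$; all Banach spaces are over $\mathbb{K}$. A pointed metric space is a metric space with a distinguished base point $0$. A map $T:X_1\times X_2\to E$ ($X_1,X_2$ pointed metric spaces, $E$ Banach) belongs to $BLip_0(X_1,X_2;E)$ if $T(x_1,0)=T(0,x_2)=0$ for all $x_1,x_2$ and there is $C>0$ with $\|T(x_1,x_2)-T(x_1,x_2')-T(x_1',x_2)+T(x_1',x_2')\|\le C\,d(x_1,x_1')d(x_2,x_2')$ for all $x_1,x_1'\in X_1$, $x_2,x_2'\in X_2$. The least such $C$ is $BLip(T)$; this is a Banach space norm on $BLip_0(X_1,X_2;E)$. (Normed) operator ideals are in the usual sense of Pietsch. The dual ideal: $u\in\mathcal{I}^{dual}(E,F)$ iff the adjoint $u^*\in\mathcal{I}(F^*,E^* )$, with $\|u\|_{\mathcal{I}^{dual}}:=\|u^*\|_{\mathcal{I}}$ when $\mathcal{I}$ is normed. The transpose of $T\in BLip_0(X_1,X_2;E)$ is the bounded linear operator $T^t:E^*\to BLip_0(X_1,X_2;\mathbb{K})$, $T^t(e^* )=e^*\circ T$. The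 two-Lipschitz dual of $\mathcal{I}$ is $$\mathcal{I}^{BLip\text{-}dual}(X_1,X_2;E)=\{T\in BLip_0(X_1,X_2;E): T^t\in\mathcal{I}(E^*,BLip_0(X_1,X_2;\mathbb{K}))\},$$ with $\|T\|_{\mathcal{I}^{BLip\text{-}dual}}:=\|T^t\|_{\mathcal{I}}$ when $\mathcal{I}$ is normed. Composition method: for an operator ideal $\mathcal{J}$, $T\in\mathcal{J}\circ BLip_0(X_1,X_2;E)$ iff there are a Banach space $F$, $S\in BLip_0(X_1,X_2;F)$ and $u\in\mathcal{J}(F,E)$ with $T=u\circ S$; if $\mathcal{J}$ is normed, $\|T\|_{\mathcal{J}\circ BLip_0}=\inf\|u\|_{\mathcal{J}}BLip(S)$, the infimum over all such factorizations. *)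

(* Defs.v *)
From HB Require Import structures.
From mathcomp Require Import all_boot all_order all_algebra.
From mathcomp Require Import all_classical all_reals topology normedtype.
From mathcomp Require Import complex.

Set Implicit Arguments.
Unset Strict Implicit.
Unset Printing Implicit Defensive.

Import Order.TTheory GRing.Theory Num.Theory.
Import numFieldNormedType.Exports.

Local Open Scope classical_set_scope.
Local Open Scope ring_scope.
Local Open Scope complex_scope.

Variant scalars := RealScalars | ComplexScalars.

Definition scalar_field (R : realType) (s : scalars) : numFieldType :=
  match s with RealScalars => R | ComplexScalars => R[i] end.

Definition re_scalar (R : realType) (s : scalars) : scalar_field R s -> R :=
  match s with RealScalars => id | ComplexScalars => @complex.Re R end.

Definition of_real (R : realType) (s : scalars) : R -> scalar_field R s :=
  match s with RealScalars => id | ComplexScalars => real_complex R end.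

Arguments re_scalar {R s}.

Section scalar_theory.
Context {R : realType} {s : scalars}.
Implicit Types (x y : R) (z : scalar_field R s).
Local Notation re := (@re_scalar R s).
Local Notation ofR := (@of_real R s).

Lemma of_realK x : re (ofR x) = x.
Proof. by case: s. Qed.

Lemma re_scalarK z : 0 <= z -> ofR (re z) = z.
Proof.
case: s z => //= z; case: z => a b.
by rewrite lecE /= => /andP[/eqP -> _].
Qed.

Lemma of_realD x y : ofR (x + y) = ofR x + ofR y.
Proof. by case: s => //=; rewrite rmorphD. Qed.

Lemma of_realM x y : ofR (x * y) = ofR x * ofR y.
Proof. by case: s => //=; rewrite rmorphM. Qed.

Lemma of_real0 : ofR 0 = 0.
Proof. by case: s. Qed.

Lemma of_real1 : ofR 1 = 1.
Proof. by case: s. Qed.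

Lemma of_real_le x y : (ofR x <= ofR y) = (x <= y).
Proof. by case: s => //=; rewrite lecR. Qed.

Lemma of_real_lt x y : (ofR x < ofR y) = (x < y).
Proof. by case: s => //=; rewrite ltcR. Qed.

Lemma re_scalarD z1 z2 : re (z1 + z2) = re z1 + re z2.
Proof. by case: s z1 z2 => //= -[a b] [c d]. Qed.

Lemma re_scalarN z : re (- z) = - re z.
Proof. by case: s z => //= -[a b]. Qed.

Lemma re_scalarM z1 z2 : 0 <= z1 -> 0 <= z2 -> re (z1 * z2) = re z1 * re z2.
Proof.
move=> z10 z20.
by rewrite -[in LHS](re_scalarK z10) -[in LHS](re_scalarK z20) -of_realM of_realK.
Qed.

Lemma re_scalar_ge0 z : 0 <= z -> 0 <= re z.
Proof. by move=> z0; rewrite -of_real_le of_real0 re_scalarK. Qed.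

Lemma le_re_scalar z1 z2 : 0 <= z1 -> z1 <= z2 -> re z1 <= re z2.
Proof.
move=> z10 z12; rewrite -of_real_le re_scalarK// re_scalarK//.
exact: le_trans z12.
Qed.

Lemma re_scalar_gt0 z : 0 < z -> 0 < re z.
Proof. by move=> z0; rewrite -of_real_lt of_real0 re_scalarK// ltW. Qed.

End scalar_theory.

(* The scalar field as a Banach space over itself, under its own name because
   the library has no completeness instance for the regular module over [R[i]]. *)
Definition scalar_space (R : realType) (s : scalars) : Type :=
  (scalar_field R s)^o.

HB.instance Definition _ (R : realType) (s : scalars) :=
  NormedModule.copy (scalar_space R s) (scalar_field R s)^o.

Lemma scalar_space_complete (R : realType) (s : scalars)
    (F : set_system (scalar_space R s)) : ProperFilter F -> cauchy F -> cvg F.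
Proof.
case: s F => F FF Fc; first exact: (@R_complete R F).
have Fc' e : 0 < e -> exists z, F [set w : R[i] | `|z - w| < e].
  move=> e0; have /cauchyP/(_ e e0)[z Fz] := Fc.
  by exists z; apply: filterS Fz => w; rewrite -ball_normE.
have aux (h : R[i] -> R) : (forall z w, `|h z - h w|%:C <= `|z - w|) ->
    exists l, forall e : R, 0 < e -> F [set z | `|l - h z| < e].
  move=> hlip.
  have hc : cvg (h @ F).
    apply: R_complete; apply/cauchyP => e e0.
    have [|z Fz] := Fc' e%:C; first by rewrite ltcR.
    exists (h z); suff : F (h @^-1` ball (h z) e) by [].
    apply: filterS Fz => w /= zw.
    rewrite -ball_normE /= -ltcR.
    exact: le_lt_trans zw.
  exists (lim (h @ F)) => e e0.
  by move/cvgrPdist_lt : hc; exact.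
have normE (z : R[i]) : `|z| = (Num.sqrt (complex.Re z ^+ 2 + complex.Im z ^+ 2))%:C.
  by case: z.
have [|lr hr] := aux (@complex.Re R).
  move=> [a b] [c d]; rewrite normE /= lecR -sqrtr_sqr ler_wsqrtr//.
  by rewrite lerDl sqr_ge0.
have [|li hi] := aux (@complex.Im R).
  move=> [a b] [c d]; rewrite normE /= lecR -sqrtr_sqr ler_wsqrtr//.
  by rewrite lerDr sqr_ge0.
apply/cvg_ex; exists (lr +i* li); apply/cvgrPdist_lt => /= e e0.
have eE : e = (complex.Re e)%:C :=
  esym (@re_scalarK R ComplexScalars e (ltW e0)).
have e0' : 0 < complex.Re e by rewrite -ltcR -eE.
have e2 : 0 < complex.Re e / 2 by rewrite divr_gt0.
apply: filterS2 (hr _ e2) (hi _ e2) => z /= zr zi.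
have dE : (lr +i* li) - z = (lr - complex.Re z)%:C + 'i%C * (li - complex.Im z)%:C.
  by case: (z) => a b; simpc.
have H1 : `|(lr - complex.Re z)%:C| < (complex.Re e / 2)%:C.
  by rewrite normE /= expr0n addr0 sqrtr_sqr ltcR.
have H2 : `|'i%C * (li - complex.Im z)%:C| < (complex.Re e / 2)%:C.
  rewrite normrM !normE /= !expr0n expr1n !add0r !addr0 sqrtr1 mul1r.
  by rewrite sqrtr_sqr ltcR.
have eE2 : e = (complex.Re e / 2)%:C + (complex.Re e / 2)%:C.
  by rewrite -rmorphD -splitr; exact: eE.
rewrite eE2 dE; apply: le_lt_trans (ltrD H1 H2); exact: ler_normD.
Qed.

HB.instance Definition _ (R : realType) (s : scalars) :=
  Uniform_isComplete.Build (scalar_space R s) (@scalar_space_complete R s).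

Section real_norm.
Context {R : realType} {s : scalars}.
Local Notation K := (scalar_field R s).

(* The norms of the library take values in the scalar field; [rnorm] is the
   same norm with values in the real numbers. *)
Definition rnorm {V : normedModType K} (x : V) : R := re_scalar `|x|.

Context {V : normedModType K}.
Implicit Types (x y : V) (a : K).

Lemma rnormE x : of_real s (rnorm x) = `|x|.
Proof. exact: re_scalarK. Qed.

Lemma rnorm_ge0 x : 0 <= rnorm x.
Proof. exact: re_scalar_ge0. Qed.

Lemma rnormD x y : rnorm (x + y) <= rnorm x + rnorm y.
Proof. by rewrite -re_scalarD le_re_scalar// ler_normD. Qed.

Lemma rnormN x : rnorm (- x) = rnorm x.
Proof. by rewrite /rnorm normrN. Qed.

Lemma rnormB x y : rnorm (x - y) = rnorm (y - x).
Proof. by rewrite /rnorm distrC. Qed.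

Lemma rnormZ a x : rnorm (a *: x) = re_scalar `|a| * rnorm x.
Proof. by rewrite /rnorm normrZ re_scalarM. Qed.

Lemma rnorm0 : rnorm (0 : V) = 0.
Proof. by rewrite /rnorm normr0 -(@of_real0 R s) of_realK. Qed.

Lemma rnorm0_eq0 x : rnorm x = 0 -> x = 0.
Proof.
by move=> x0; apply/normr0_eq0; rewrite -rnormE x0 of_real0.
Qed.

Lemma rnorm_le_norm x (C : R) : (`|x| <= of_real s C) = (rnorm x <= C).
Proof. by rewrite -rnormE of_real_le. Qed.

Lemma cvg_rnorm_le {T : Type} (G : set_system T) (h : T -> V) (l : V) (C : R) :
  ProperFilter G -> h v @[v --> G] --> l ->
  (\forall v \near G, rnorm (h v) <= C) -> rnorm l <= C.
Proof.
move=> GF hl hC; apply/ler_addgt0Pr => e e0.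
near G => v.
have hv : rnorm (h v) <= C by near: v.
have lv : rnorm (l - h v) <= e.
  rewrite -rnorm_le_norm ltW//; near: v.
  by move/cvgrPdist_lt : hl; apply; rewrite -(@of_real0 R s) of_real_lt.
by rewrite -(subrK (h v) l) (le_trans (rnormD _ _))// addrC lerD.
Unshelve. all: by end_near. Qed.

End real_norm.

(* Completeness of a normed space of functions in which bounded sets are stable
   under pointwise limits. *)
Lemma complete_of_eval (R : realType) (s : scalars)
    (V : normedModType (scalar_field R s)) (T : Type)
    (F : completeNormedModType (scalar_field R s))
    (ev : V -> T -> F) (c : T -> R) :
  (forall t, 0 <= c t) ->
  (forall v w t, rnorm (ev v t - ev w t) <= c t * rnorm (v - w)) ->
  (forall (G : set_system V) (f : T -> F), ProperFilter G ->
    (forall t, ev v t @[v --> G] --> f t) ->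
    (exists v0 C, \forall v \near G, rnorm (v - v0) <= C) ->
    exists v, ev v = f) ->
  (forall (G : set_system V) (u w : V) (C : R), ProperFilter G -> 0 <= C ->
    (forall t, ev v t @[v --> G] --> ev u t) ->
    (\forall v \near G, rnorm (v - w) <= C) -> rnorm (u - w) <= C) ->
  forall G : set_system V, ProperFilter G -> cauchy G -> cvg G.
Proof.
move=> c0 evlip evlim evcl G GF Gc.
have Gr (e : R) : 0 < e -> \forall v & w \near G, rnorm (v - w) < e.
  move=> e0; have := (@cauchy_ballP _ _ G GF).2 Gc (of_real s e).
  rewrite -(@of_real0 R s) of_real_lt => /(_ e0).
  apply: filterS => -[v w]; rewrite -ball_normE /=.
  by rewrite -rnormE of_real_lt.
have evc t : cvg (ev v t @[v --> G]).
  apply/cauchy_cvgP/cauchy_ballP => e e0; rewrite near_map2.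
  have ct1 : 0 < c t + 1 by rewrite ltr_wpDl.
  have e0' := re_scalar_gt0 e0.
  have := Gr (re_scalar e / (c t + 1)) (divr_gt0 e0' ct1).
  apply: filterS => -[v w] /= vw.
  rewrite -ball_normE /= -rnormE -[ltRHS](re_scalarK (ltW e0)) of_real_lt.
  rewrite (le_lt_trans (evlip _ _ _))//.
  rewrite (@le_lt_trans _ _ ((c t + 1) * rnorm (v - w)))//.
    by rewrite ler_wpM2r ?rnorm_ge0 ?lerDl.
  by rewrite mulrC -ltr_pdivlMr.
have [|u uE] := evlim G (fun t => lim (ev v t @[v --> G])) GF evc.
  have [[A B] /= [GA GB] AB] := Gr 1 ltr01.
  have [w Bw] := @filter_ex _ G GF _ GB.
  by exists w, 1; apply: filterS GA => v Av; apply/ltW/(AB (v, w)).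
apply/cvg_ex; exists u; apply/cvgrPdist_le => e e0.
have [[A B] /= [GA GB] AB] := Gr _ (re_scalar_gt0 e0).
apply: filterS GB => w Bw.
rewrite -[leRHS](re_scalarK (ltW e0)) rnorm_le_norm.
apply: (evcl G) => //; first by rewrite ltW// re_scalar_gt0.
  by move=> t; rewrite uE; exact: evc.
by apply: filterS GA => v Av; apply/ltW/(AB (v, w)).
Qed.

Section least_bound.
Context {R : realType}.
Variable B : R -> Prop.
Let A : set R := [set C | 0 < C /\ B C].

Lemma inf_ge0 : 0 <= inf A.
Proof.
have [[x Ax]|] := pselect (A !=set0).
  by apply: lb_le_inf; [exists x|move=> y [/ltW]].
by move/set0P/negP; rewrite negbK => /eqP ->; rewrite inf0.
Qed.

Lemma inf_le C : (forall x y, x <= y -> B x -> B y) -> 0 <= C -> B C ->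
  inf A <= C.
Proof.
move=> Bmono C0 BC; apply/ler_addgt0Pr => e e0.
apply: ge_inf; first by exists 0 => y [/ltW].
by split; [rewrite ltr_wpDl|apply: Bmono BC; rewrite lerDl ltW].
Qed.

Lemma inf_attained : (forall x y, x <= y -> B x -> B y) ->
  (forall x, (forall e, 0 < e -> B (x + e)) -> B x) ->
  (exists C, B C) -> B (inf A).
Proof.
move=> Bmono Bcl [C BC]; apply: Bcl => e e0.
have hA : has_inf A.
  split; last by exists 0 => y [/ltW].
  exists (`|C| + 1); split; first by rewrite ltr_wpDl.
  by apply: Bmono BC; rewrite (le_trans (ler_norm C))// lerDl.
have [x [_ Bx]] := inf_adherent e0 hA.
by move/ltW => xe; exact: Bmono Bx.
Qed.

End least_bound.

Section bounded_operators.
Context {R : realType} {s : scalars}.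
Local Notation K := (scalar_field R s).

Section definition.
Variables E F : normedModType K.

Definition bounded_linear (f : E -> F) : Prop :=
  linear f /\ exists C : R, forall x, rnorm (f x) <= C * rnorm x.

Definition bounded_linear_pred : {pred E -> F} := fun f => `[< bounded_linear f >].

Lemma bounded_linear_predP f : reflect (bounded_linear f) (f \in bounded_linear_pred).
Proof. exact: asboolP. Qed.

Record bop := BOp {
  bop_fun :> E -> F;
  bop_in : bop_fun \in bounded_linear_pred
}.

HB.instance Definition _ := [isSub for bop_fun].
HB.instance Definition _ := [Choice of bop by <:].

Lemma bounded_linear_submod : submod_closed bounded_linear_pred.
Proof.
split.
  apply/bounded_linear_predP; split; first by move=> a x y; rewrite scaler0 addr0.
  by exists 0 => x; rewrite rnorm0 mul0r.
move=> a f g /bounded_linear_predP[fl [Cf fC]] /bounded_linear_predP[gl [Cg gC]].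
apply/bounded_linear_predP; split.
  move=> b x y /=; rewrite !fctE fl gl scalerDr scalerDr !scalerA mulrC.
  by rewrite addrACA.
exists (re_scalar `|a| * Cf + Cg) => x.
rewrite mulrDl (le_trans (rnormD _ _))// lerD// rnormZ -mulrA.
by rewrite ler_wpM2l// re_scalar_ge0.
Qed.

HB.instance Definition _ := GRing.isSubmodClosed.Build K (E -> F)
  bounded_linear_pred bounded_linear_submod.
HB.instance Definition _ := [SubChoice_isSubLmodule of bop by <:].

Lemma bopP (f g : bop) : f =1 g -> f = g.
Proof. by move=> fg; apply/val_inj/funext. Qed.

Lemma bop_linear (f : bop) : linear f.
Proof. by have /bounded_linear_predP[] := bop_in f. Qed.

Lemma bop_bounded (f : bop) : exists C : R, forall x, rnorm (f x) <= C * rnorm x.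
Proof. by have /bounded_linear_predP[] := bop_in f. Qed.

Lemma bopDE (f g : bop) x : (f + g) x = f x + g x.
Proof. by []. Qed.

Lemma bopBE (f g : bop) x : (f - g) x = f x - g x.
Proof. by []. Qed.

Lemma bopZE (a : K) (f : bop) x : (a *: f) x = a *: f x.
Proof. by []. Qed.

Lemma bop0 (f : bop) : f 0 = 0.
Proof.
by have := bop_linear f (-1) 0 0; rewrite scaleN1r oppr0 addr0 scaleN1r addNr.
Qed.

Definition opnorm (f : bop) : R :=
  inf [set C | 0 < C /\ forall x, rnorm (f x) <= C * rnorm x].

Lemma opnorm_ge0 f : 0 <= opnorm f.
Proof. exact: inf_ge0. Qed.

Lemma opnorm_le (f : bop) C : 0 <= C ->
  (forall x, rnorm (f x) <= C * rnorm x) -> opnorm f <= C.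
Proof.
move=> C0 fC; apply: inf_le => // a b ab fa x.
by rewrite (le_trans (fa x))// ler_wpM2r ?rnorm_ge0.
Qed.

Lemma opnormP (f : bop) x : rnorm (f x) <= opnorm f * rnorm x.
Proof.
move: x; apply: inf_attained (bop_bounded f).
  by move=> a b ab fa x; rewrite (le_trans (fa x))// ler_wpM2r ?rnorm_ge0.
move=> C CP x; apply/ler_addgt0Pr => e e0.
have d0 : 0 < rnorm x + 1 by rewrite ltr_wpDl ?rnorm_ge0.
rewrite (le_trans (CP (e / (rnorm x + 1)) _ x)) ?divr_gt0//.
by rewrite mulrDl lerD2l mulrAC ler_pdivrMr// ler_wpM2l ?(ltW e0)// lerDl.
Qed.

Let norm (f : bop) : K := of_real s (opnorm f).

Let normD f g : norm (f + g) <= norm f + norm g.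
Proof.
rewrite -of_realD of_real_le opnorm_le ?addr_ge0 ?opnorm_ge0// => x.
by rewrite (le_trans (rnormD _ _))// mulrDl lerD ?opnormP.
Qed.

Let normZ (a : K) f : norm (a *: f) = `|a| * norm f.
Proof.
rewrite -[`|a|]re_scalarK// -of_realM; congr of_real.
have le_normZ (b : K) (g : bop) : opnorm (b *: g) <= re_scalar `|b| * opnorm g.
  rewrite opnorm_le ?mulr_ge0 ?opnorm_ge0 ?re_scalar_ge0// => x.
  by rewrite rnormZ -mulrA ler_wpM2l ?re_scalar_ge0// opnormP.
apply/le_anti; rewrite le_normZ /=.
have [->|a0] := eqVneq a 0.
  by rewrite normr0 -(@of_real0 R s) of_realK mul0r opnorm_ge0.
have a0' : 0 < re_scalar `|a| by rewrite re_scalar_gt0// normr_gt0.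
have -> : opnorm f = opnorm (a^-1 *: (a *: f)) by rewrite scalerA mulVf// scale1r.
rewrite (le_trans (ler_wpM2l (ltW a0') (le_normZ _ _)))//.
rewrite mulrA -re_scalarM// -normrM mulfV// normr1.
by rewrite -(@of_real1 R s) of_realK mul1r.
Qed.

Let norm0_eq0 f : norm f = 0 -> f = 0.
Proof.
move/(congr1 re_scalar); rewrite of_realK -(@of_real0 R s) of_realK => f0.
apply/bopP => x; apply/rnorm0_eq0/le_anti.
by rewrite rnorm_ge0 andbT (le_trans (opnormP _ _))// f0 mul0r.
Qed.

HB.instance Definition _ := Lmodule_isNormed.Build K bop normD normZ norm0_eq0.

Lemma rnorm_bop (f : bop) : rnorm f = opnorm f.
Proof. exact: of_realK. Qed.

End definition.

Lemma bop_complete (E : normedModType K) (F : completeNormedModType K)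
  (G : set_system (bop E F)) : ProperFilter G -> cauchy G -> cvg G.
Proof.
move: G; apply: (@complete_of_eval _ _ _ _ _ (@bop_fun E F) (@rnorm _ _ E)).
- by move=> x; exact: rnorm_ge0.
- by move=> f g x; rewrite -bopBE mulrC rnorm_bop opnormP.
- move=> G f GF Gf [f0 [C Gf0]].
  have flin : linear f.
    move=> a x y; apply: (norm_cvg_unique (Gf _)).
    have -> : (fun g : bop E F => g (a *: x + y)) = (fun g => a *: g x + g y).
      by apply/funext => g; exact: bop_linear.
    by apply: cvgD (Gf y); apply: cvgZ (Gf x); exact: cvg_cst.
  have fbd : exists C : R, forall x, rnorm (f x) <= C * rnorm x.
    exists (C + opnorm f0) => x; apply: (cvg_rnorm_le GF (Gf x)).
    apply: filterS Gf0 => g gf0.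
    rewrite -[g](subrK f0) bopDE (le_trans (rnormD _ _))// mulrDl.
    rewrite lerD ?opnormP// (le_trans (opnormP _ _))// -rnorm_bop.
    by rewrite ler_wpM2r ?rnorm_ge0.
  have fP : f \in @bounded_linear_pred E F by apply/bounded_linear_predP.
  by exists (BOp fP).
- move=> G f w C GF C0 Gf Gw; rewrite rnorm_bop opnorm_le// => x.
  rewrite bopBE; apply: (cvg_rnorm_le GF (cvgB (Gf x) (cvg_cst (w x)))).
  apply: filterS Gw => g gw; rewrite -[_ - _]bopBE.
  by rewrite (le_trans (opnormP _ _))// ler_wpM2r ?rnorm_ge0// -rnorm_bop.
Qed.

HB.instance Definition _ (E : normedModType K) (F : completeNormedModType K) :=
  Uniform_isComplete.Build (bop E F) (@bop_complete E F).

Lemma bounded_linear_id (E : normedModType K) :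
  (id : E -> E) \in @bounded_linear_pred E E.
Proof.
by apply/bounded_linear_predP; split => //; exists 1 => x; rewrite mul1r.
Qed.

Definition bop_id (E : normedModType K) : bop E E := BOp (bounded_linear_id E).

Lemma bounded_linear_comp (E F G : normedModType K) (v : bop F G) (u : bop E F) :
  v \o u \in @bounded_linear_pred E G.
Proof.
apply/bounded_linear_predP; split=> [a x y /=|]; first by rewrite !bop_linear.
exists (opnorm v * opnorm u) => x /=.
by rewrite (le_trans (opnormP _ _))// -mulrA ler_wpM2l ?opnorm_ge0// opnormP.
Qed.

Definition bop_comp (E F G : normedModType K) (v : bop F G) (u : bop E F) :
  bop E G := BOp (bounded_linear_comp v u).

Definition dual (E : normedModType K) : completeNormedModType K :=
  bop E (scalar_space R s).

Lemma bounded_linear_adjoint (E F : normedModType K) (u : bop E F) :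
  (fun e : dual F => (bop_comp e u : dual E)) \in
    @bounded_linear_pred (dual F) (dual E).
Proof.
apply/bounded_linear_predP; split=> [a x y|]; first exact: bopP.
exists (opnorm u) => e; rewrite [leLHS]rnorm_bop [X in _ * X]rnorm_bop.
rewrite opnorm_le ?mulr_ge0 ?opnorm_ge0// => x /=.
rewrite (le_trans (opnormP _ _))// [opnorm u * _]mulrC -mulrA.
by rewrite ler_wpM2l ?opnorm_ge0// opnormP.
Qed.

Definition adjoint (E F : normedModType K) (u : bop E F) : bop (dual F) (dual E) :=
  BOp (bounded_linear_adjoint u).

End bounded_operators.

(* The base point is [point]. *)
#[short(type="pointedMetricType")]
HB.structure Definition PointedMetric (R : numDomainType) :=
  {X of Metric R X & isPointed X}.

Section two_lipschitz.
Context {R : realType} {s : scalars}.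
Local Notation K := (scalar_field R s).

Section definition.
Variables (X1 X2 : pointedMetricType R) (E : normedModType K).
Implicit Types (T : X1 * X2 -> E) (C : R).

Definition two_lipschitz_bound T C : Prop :=
  forall (x1 x1' : X1) (x2 x2' : X2),
    rnorm (T (x1, x2) - T (x1, x2') - T (x1', x2) + T (x1', x2'))
      <= C * mdist x1 x1' * mdist x2 x2'.

Definition two_lipschitz0 T : Prop :=
  [/\ forall x1, T (x1, point) = 0,
      forall x2, T (point, x2) = 0 &
      exists C, 0 < C /\ two_lipschitz_bound T C].

Definition two_lipschitz0_pred : {pred X1 * X2 -> E} :=
  fun T => `[< two_lipschitz0 T >].

Lemma two_lipschitz0_predP T :
  reflect (two_lipschitz0 T) (T \in two_lipschitz0_pred).
Proof. exact: asboolP. Qed.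

Record blip0 := BLip0 {
  blip0_fun :> X1 * X2 -> E;
  blip0_in : blip0_fun \in two_lipschitz0_pred
}.

HB.instance Definition _ := [isSub for blip0_fun].
HB.instance Definition _ := [Choice of blip0 by <:].

Let mixedD T1 T2 x1 x1' x2 x2' :
  (T1 + T2) (x1, x2) - (T1 + T2) (x1, x2') - (T1 + T2) (x1', x2)
    + (T1 + T2) (x1', x2') =
  (T1 (x1, x2) - T1 (x1, x2') - T1 (x1', x2) + T1 (x1', x2')) +
  (T2 (x1, x2) - T2 (x1, x2') - T2 (x1', x2) + T2 (x1', x2')).
Proof. by rewrite !fctE !opprD !addrA [RHS](ACl (1*5*2*6*3*7*4*8)). Qed.

Let mixedZ (a : K) T x1 x1' x2 x2' :
  (a *: T) (x1, x2) - (a *: T) (x1, x2') - (a *: T) (x1', x2)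
    + (a *: T) (x1', x2') =
  a *: (T (x1, x2) - T (x1, x2') - T (x1', x2) + T (x1', x2')).
Proof. by rewrite !fctE scalerDr !scalerBr. Qed.

Let boundD T1 T2 C1 C2 : two_lipschitz_bound T1 C1 ->
  two_lipschitz_bound T2 C2 -> two_lipschitz_bound (T1 + T2) (C1 + C2).
Proof.
move=> h1 h2 x1 x1' x2 x2'; rewrite mixedD.
by rewrite (le_trans (rnormD _ _))// !mulrDl lerD.
Qed.

Let boundZ (a : K) T C : two_lipschitz_bound T C ->
  two_lipschitz_bound (a *: T) (re_scalar `|a| * C).
Proof.
move=> h x1 x1' x2 x2'; rewrite mixedZ rnormZ -!mulrA.
by rewrite ler_wpM2l ?re_scalar_ge0// mulrA.
Qed.

Let bound_mono T C C' : C <= C' -> two_lipschitz_bound T C ->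
  two_lipschitz_bound T C'.
Proof.
move=> CC h x1 x1' x2 x2'; rewrite (le_trans (h _ _ _ _))//.
by rewrite !ler_wpM2r ?mdist_ge0.
Qed.

Lemma two_lipschitz0_submod : submod_closed two_lipschitz0_pred.
Proof.
split.
  apply/two_lipschitz0_predP; split => //; exists 1; split => // x1 x1' x2 x2'.
  by rewrite !subr0 addr0 rnorm0 mul1r mulr_ge0 ?mdist_ge0.
move=> a S T /two_lipschitz0_predP[Sr Sl [C [C0 SC]]].
move=> /two_lipschitz0_predP[Tr Tl [D [D0 TD]]].
apply/two_lipschitz0_predP; split.
- by move=> x1; rewrite !fctE Sr Tr scaler0 addr0.
- by move=> x2; rewrite !fctE Sl Tl scaler0 addr0.
exists (re_scalar `|a| * C + D); split; last exact/boundD/TD/boundZ.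
by rewrite ltr_wpDl// mulr_ge0// ?re_scalar_ge0// ltW.
Qed.

HB.instance Definition _ := GRing.isSubmodClosed.Build K (X1 * X2 -> E)
  two_lipschitz0_pred two_lipschitz0_submod.
HB.instance Definition _ := [SubChoice_isSubLmodule of blip0 by <:].

Lemma blip0P (S T : blip0) : S =1 T -> S = T.
Proof. by move=> ST; apply/val_inj/funext. Qed.

Lemma blip0_prop (T : blip0) : two_lipschitz0 T.
Proof. exact/two_lipschitz0_predP/blip0_in. Qed.

Definition blip (T : blip0) : R :=
  inf [set C | 0 < C /\ two_lipschitz_bound T C].

Lemma blip_ge0 (T : blip0) : 0 <= blip T.
Proof. exact: inf_ge0. Qed.

Lemma blip_le (T : blip0) C : 0 <= C -> two_lipschitz_bound T C -> blip T <= C.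
Proof. by move=> C0 TC; apply: inf_le => // a b; exact: bound_mono. Qed.

Lemma blipP (T : blip0) : two_lipschitz_bound T (blip T).
Proof.
apply: inf_attained; first by move=> a b; exact: bound_mono.
  move=> C CP x1 x1' x2 x2'; apply/ler_addgt0Pr => e e0.
  pose d := mdist x1 x1' * mdist x2 x2'.
  have d0 : 0 <= d by rewrite mulr_ge0 ?mdist_ge0.
  have d1 : 0 < d + 1 by rewrite ltr_wpDl.
  rewrite (le_trans (CP (e / (d + 1)) _ x1 x1' x2 x2')) ?divr_gt0//.
  by rewrite -!mulrA mulrDl lerD2l mulrAC ler_pdivrMr// ler_wpM2l ?(ltW e0)// lerDl.
by have [_ _ [C [_ CP]]] := blip0_prop T; exists C.
Qed.

Let norm (T : blip0) : K := of_real s (blip T).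

Let normD (S T : blip0) : norm (S + T) <= norm S + norm T.
Proof.
rewrite -of_realD of_real_le blip_le ?addr_ge0 ?blip_ge0//.
exact: boundD (blipP _) (blipP _).
Qed.

Let normZ (a : K) (T : blip0) : norm (a *: T) = `|a| * norm T.
Proof.
rewrite -[`|a|]re_scalarK// -of_realM; congr of_real.
have le_normZ (b : K) (S : blip0) : blip (b *: S) <= re_scalar `|b| * blip S.
  rewrite blip_le ?mulr_ge0 ?blip_ge0 ?re_scalar_ge0//.
  exact: boundZ (blipP _).
apply/le_anti; rewrite le_normZ /=.
have [->|a0] := eqVneq a 0.
  by rewrite normr0 -(@of_real0 R s) of_realK mul0r blip_ge0.
have a0' : 0 < re_scalar `|a| by rewrite re_scalar_gt0// normr_gt0.
have -> : blip T = blip (a^-1 *: (a *: T)) by rewrite scalerA mulVf// scale1r.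
rewrite (le_trans (ler_wpM2l (ltW a0') (le_normZ _ _)))//.
rewrite mulrA -re_scalarM// -normrM mulfV// normr1.
by rewrite -(@of_real1 R s) of_realK mul1r.
Qed.

Lemma blip0_le (T : blip0) x :
  rnorm (T x) <= mdist x.1 point * mdist x.2 point * blip T.
Proof.
have [Tr Tl _] := blip0_prop T; case: x => x1 x2 /=.
have := blipP T x1 point x2 point; rewrite Tr !Tl !subr0 addr0.
by rewrite -mulrA mulrC.
Qed.

Let norm0_eq0 (T : blip0) : norm T = 0 -> T = 0.
Proof.
move/(congr1 re_scalar); rewrite of_realK -(@of_real0 R s) of_realK => T0.
apply/blip0P => x; apply/rnorm0_eq0/le_anti.
by rewrite rnorm_ge0 andbT (le_trans (blip0_le _ _))// T0 mulr0.
Qed.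

HB.instance Definition _ := Lmodule_isNormed.Build K blip0 normD normZ norm0_eq0.

Lemma rnorm_blip0 (T : blip0) : rnorm T = blip T.
Proof. exact: of_realK. Qed.

Lemma blip0DE (S T : blip0) x : (S + T) x = S x + T x.
Proof. by []. Qed.

Lemma blip0BE (S T : blip0) x : (S - T) x = S x - T x.
Proof. by []. Qed.

Lemma blip0ZE (a : K) (T : blip0) x : (a *: T) x = a *: T x.
Proof. by []. Qed.

End definition.

Lemma blip0_complete (X1 X2 : pointedMetricType R) (E : completeNormedModType K)
  (G : set_system (blip0 X1 X2 E)) : ProperFilter G -> cauchy G -> cvg G.
Proof.
move: G; apply: (@complete_of_eval _ _ _ _ _ (@blip0_fun X1 X2 E)
  (fun x => mdist x.1 point * mdist x.2 point)).
- by move=> x; rewrite mulr_ge0 ?mdist_ge0.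
- by move=> S T x; rewrite -blip0BE rnorm_blip0 blip0_le.
- move=> G T GF GT [T0 [C GT0]].
  have cvg0 x : (forall S : blip0 X1 X2 E, S x = 0) -> T x = 0.
    move=> S0; apply: (norm_cvg_unique (GT x)).
    by rewrite (_ : (fun S => _) = fun=> 0); [exact: cvg_cst|exact/funext].
  have TP : T \in @two_lipschitz0_pred X1 X2 E.
    apply/two_lipschitz0_predP; split.
    + by move=> x1; apply: cvg0 => S; have [->] := blip0_prop S.
    + by move=> x2; apply: cvg0 => S; have [_ ->] := blip0_prop S.
    exists (`|C| + blip T0 + 1); split.
      by rewrite ltr_wpDl// addr_ge0// blip_ge0.
    move=> x1 x1' x2 x2'.
    apply: (cvg_rnorm_le GF (cvgD (cvgB (cvgB (GT _) (GT _)) (GT _)) (GT _))).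
    apply: filterS GT0 => S ST0.
    rewrite (le_trans (blipP S _ _ _ _))// !ler_wpM2r ?mdist_ge0//.
    rewrite -!rnorm_blip0 -[S](subrK T0) (le_trans (rnormD _ _))//.
    rewrite -addrA lerD ?lerDl// (le_trans ST0)//.
    exact: ler_norm.
  by exists (BLip0 TP).
- move=> G T W C GF C0 GT GW; rewrite rnorm_blip0 blip_le// => x1 x1' x2 x2'.
  have GTW x : (S - W) x @[S --> G] --> (T - W) x.
    exact: cvgB (GT x) (cvg_cst (W x)).
  apply: (cvg_rnorm_le GF (cvgD (cvgB (cvgB (GTW _) (GTW _)) (GTW _)) (GTW _))).
  apply: filterS GW => S SW.
  rewrite (le_trans (blipP (S - W) x1 x1' x2 x2'))//.
  by rewrite !ler_wpM2r ?mdist_ge0// -rnorm_blip0.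
Qed.

HB.instance Definition _ (X1 X2 : pointedMetricType R)
    (E : completeNormedModType K) :=
  Uniform_isComplete.Build (blip0 X1 X2 E) (@blip0_complete X1 X2 E).

Section composition.
Variables (X1 X2 : pointedMetricType R) (F E : normedModType K).

Lemma two_lipschitz_bound_comp (u : bop F E) (S : blip0 X1 X2 F) :
  two_lipschitz_bound (u \o S) (opnorm u * blip S).
Proof.
move=> x1 x1' x2 x2' /=.
have uB x y : u x - u y = u (x - y).
  by rewrite addrC -scaleN1r -bop_linear scaleN1r addrC.
have uD x y : u x + u y = u (x + y).
  by rewrite -[u x]scale1r -bop_linear scale1r.
rewrite !uB uD (le_trans (opnormP _ _))// -!mulrA ler_wpM2l ?opnorm_ge0//.
by rewrite mulrA blipP.
Qed.

Lemma two_lipschitz0_comp (u : bop F E) (S : blip0 X1 X2 F) :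
  u \o S \in @two_lipschitz0_pred X1 X2 E.
Proof.
apply/two_lipschitz0_predP; have [Sr Sl _] := blip0_prop S; split.
- by move=> x1 /=; rewrite Sr bop0.
- by move=> x2 /=; rewrite Sl bop0.
exists (opnorm u * blip S + 1); split.
  by rewrite ltr_wpDl// mulr_ge0 ?opnorm_ge0 ?blip_ge0.
move=> x1 x1' x2 x2'; rewrite (le_trans (two_lipschitz_bound_comp _ _ _ _ _ _))//.
by rewrite !ler_wpM2r ?mdist_ge0// lerDl.
Qed.

Definition blip0_comp (u : bop F E) (S : blip0 X1 X2 F) : blip0 X1 X2 E :=
  BLip0 (two_lipschitz0_comp u S).

End composition.

Definition blip0_dual (X1 X2 : pointedMetricType R) : completeNormedModType K :=
  blip0 X1 X2 (scalar_space R s).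

Lemma bounded_linear_transpose (X1 X2 : pointedMetricType R)
    (E : normedModType K) (T : blip0 X1 X2 E) :
  (fun e : dual E => (blip0_comp e T : blip0_dual X1 X2)) \in
    @bounded_linear_pred R s (dual E) (blip0_dual X1 X2).
Proof.
apply/bounded_linear_predP; split=> [a x y|]; first exact: blip0P.
exists (blip T) => e; rewrite [leLHS]rnorm_blip0 [X in _ * X]rnorm_bop.
rewrite blip_le ?mulr_ge0 ?opnorm_ge0 ?blip_ge0// mulrC.
exact: two_lipschitz_bound_comp.
Qed.

Definition transpose (X1 X2 : pointedMetricType R) (E : normedModType K)
    (T : blip0 X1 X2 E) : bop (dual E) (blip0_dual X1 X2) :=
  BOp (bounded_linear_transpose T).

End two_lipschitz.

Section operator_ideals.
Variables (R : realType) (s : scalars).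
Local Notation K := (scalar_field R s).

(* Both range over all pairs of Banach spaces over [K]; the value of a gauge
   is only constrained, and only used, on the members of the ideal. *)
Definition op_class := forall E F : completeNormedModType K, set (bop E F).
Definition op_gauge := forall E F : completeNormedModType K, bop E F -> R.

(* Closure under scalar multiples and the membership of the finite rank
   operators follow from the three axioms below. *)
Record operator_ideal (I : op_class) : Prop := OperatorIdeal {
  ideal_id : I _ _ (bop_id (scalar_space R s));
  ideal_add : forall (E F : completeNormedModType K) (u v : bop E F),
    I E F u -> I E F v -> I E F (u + v);
  ideal_comp : forall (E0 E F F0 : completeNormedModType K)
    (t : bop E0 E) (u : bop E F) (r : bop F F0),
    I E F u -> I E0 F0 (bop_comp r (bop_comp u t))
}.

(* Pietsch's norms on an ideal; definiteness and homogeneity on each component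
   follow from these axioms. *)
Record normed_operator_ideal (I : op_class) (N : op_gauge) : Prop :=
  NormedOperatorIdeal {
  normed_ideal : operator_ideal I;
  ideal_norm_ge0 : forall (E F : completeNormedModType K) (u : bop E F),
    I E F u -> 0 <= N E F u;
  ideal_norm_id : N _ _ (bop_id (scalar_space R s)) = 1;
  ideal_norm_add : forall (E F : completeNormedModType K) (u v : bop E F),
    I E F u -> I E F v -> N E F (u + v) <= N E F u + N E F v;
  ideal_norm_comp : forall (E0 E F F0 : completeNormedModType K)
    (t : bop E0 E) (u : bop E F) (r : bop F F0),
    I E F u -> N E0 F0 (bop_comp r (bop_comp u t)) <= opnorm r * N E F u * opnorm t
}.

Definition dual_ideal (I : op_class) : op_class :=
  fun E F u => I (dual F) (dual E) (adjoint u).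

Definition dual_ideal_norm (N : op_gauge) : op_gauge :=
  fun E F u => N (dual F) (dual E) (adjoint u).

Section two_lipschitz_ideals.
Variables (X1 X2 : pointedMetricType R) (E : completeNormedModType K).

Definition blip_dual (I : op_class) : set (blip0 X1 X2 E) :=
  [set T | I (dual E) (blip0_dual X1 X2) (transpose T)].

Definition blip_dual_norm (N : op_gauge) (T : blip0 X1 X2 E) : R :=
  N (dual E) (blip0_dual X1 X2) (transpose T).

Definition blip_comp (J : op_class) : set (blip0 X1 X2 E) :=
  [set T | exists (F : completeNormedModType K) (S : blip0 X1 X2 F)
             (u : bop F E), J F E u /\ T = blip0_comp u S].

Definition blip_comp_norm (J : op_class) (N : op_gauge) (T : blip0 X1 X2 E) : R :=
  inf [set c | exists (F : completeNormedModType K) (S : blip0 X1 X2 F)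
                 (u : bop F E),
                 [/\ J F E u, T = blip0_comp u S & c = N F E u * blip S]].

End two_lipschitz_ideals.

End operator_ideals.

Arguments blip_dual {R s} X1 X2 E I.
Arguments blip_dual_norm {R s X1 X2 E} N T.
Arguments blip_comp {R s} X1 X2 E J.
Arguments blip_comp_norm {R s X1 X2 E} J N T.

(* Main.v *)
From HB Require Import structures.
Require Import Defs.
From mathcomp Require Import all_boot all_order all_algebra.
From mathcomp Require Import all_classical all_reals topology normedtype.

Set Implicit Arguments.
Unset Strict Implicit.
Unset Printing Implicit Defensive.

Import Order.TTheory GRing.Theory Num.Theory.
Import numFieldNormedType.Exports.

Local Open Scope classical_set_scope.
Local Open Scope ring_scope.

(** The transpose of a composition [u o S] is [S^t o u^*], so a factorization
    [T = u o S] with [u^*] in the ideal puts [T^t] in the ideal, with norm at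
    most [blip S] times that of [u^*] ([transpose_comp], [opnorm_transpose]).

    Conversely, [T] has to be factored as [u o S] in such a way that [u^*] is
    itself [r o T^t] for some operator [r] on [BLip_0(X1, X2; K)]; if [blip S]
    and the norm of [r] are at most one, then both the inclusion and the
    inequality between norms follow ([blip_factorization]).  The natural
    candidate is the linearization of [T] on the predual of
    [BLip_0(X1, X2; K)], the closed span of the evaluations [dirac x] in the
    dual of that space.  But the boundedness of this linearization relies on
    the Hahn-Banach theorem in [E].  A larger space [F] makes it bounded by
    construction: it consists of the pairs [(v, y)], with [v] a functional on
    [BLip_0(X1, X2; K)] and [y] in [E], such that [v (e o T) = a * e y] for
    every functional [e] on [E], under the norm max(|v|, |y|).  Here the
    scalar [a = blip T + 1] is positive and at least [blip T].  Then
    - [F] is a pullback of Banach spaces, hence a Banach space;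
    - [S x = (dirac x, a^-1 T x)] lies in [F], and [blip S <= 1] by the choice
      of [a];
    - [u (v, y) = a y] satisfies [u o S = T];
    - the equations that define [F] say exactly that [u^* = r o T^t], where
      [r f] is the functional [(v, y) |-> v f] and has norm at most that of
      [f]. *)

(** * Bounded operators *)

Section operators.
Context {R : realType} {s : scalars}.
Local Notation K := (scalar_field R s).

Lemma opnorm_id (E : normedModType K) : opnorm (bop_id E) <= 1.
Proof. by apply: opnorm_le => // x; rewrite mul1r. Qed.

Lemma bopB (E F : normedModType K) (f : bop E F) x y : f (x - y) = f x - f y.
Proof. by rewrite addrC -scaleN1r bop_linear scaleN1r addrC. Qed.

Lemma bopZ (E F : normedModType K) (f : bop E F) (a : K) x :
  f (a *: x) = a *: f x.
Proof. by rewrite -[a *: x]addr0 bop_linear bop0 addr0. Qed.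

Lemma bop_small (E F : normedModType K) (f : bop E F) (e : K) : 0 < e ->
  exists2 d : K, 0 < d & forall x, `|x| < d -> `|f x| < e.
Proof.
move=> e0; have c0 : 0 < opnorm f + 1 by rewrite ltr_wpDl ?opnorm_ge0.
exists (of_real s (re_scalar e / (opnorm f + 1))).
  by rewrite -(@of_real0 R s) of_real_lt divr_gt0// re_scalar_gt0.
move=> x; rewrite -!rnormE of_real_lt ltr_pdivlMr// => xe.
rewrite -[ltRHS](re_scalarK (ltW e0)) of_real_lt.
apply: le_lt_trans xe; rewrite (le_trans (opnormP _ _))// mulrC.
by rewrite ler_wpM2l ?rnorm_ge0// lerDl.
Qed.

Lemma cvg_bop (E F : normedModType K) (f : bop E F) (T : Type)
    (G : set_system T) (h : T -> E) (l : E) :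
  Filter G -> h v @[v --> G] --> l -> f (h v) @[v --> G] --> f l.
Proof.
move=> GF hl; apply/cvgrPdist_lt => e /(bop_small f)[d d0 fd].
move/cvgrPdist_lt : hl => /(_ _ d0); apply: filterS => v.
by rewrite -bopB; exact: fd.
Qed.

Lemma cvg_bop_cauchy (E : normedModType K) (F : completeNormedModType K)
    (f : bop E F) (G : set_system E) :
  ProperFilter G -> cauchy G -> cvg (f v @[v --> G]).
Proof.
move=> GF Gc; apply/cauchy_cvgP/cauchy_ballP => e /(bop_small f)[d d0 fd].
rewrite near_map2; have := (@cauchy_ballP _ _ G GF).2 Gc _ d0.
by apply: filterS => -[v w] /=; rewrite -!ball_normE /= -bopB; exact: fd.
Qed.

Lemma bounded_linear_eval (E : normedModType K) (x : E) :
  (fun e : dual E => e x) \in @bounded_linear_pred R s (dual E) (scalar_space R s).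
Proof.
apply/bounded_linear_predP; split=> [//|].
by exists (rnorm x) => e; rewrite rnorm_bop mulrC opnormP.
Qed.

Lemma bounded_linear_bidual (E : normedModType K) :
  (fun x : E => (BOp (bounded_linear_eval x) : dual (dual E)))
    \in @bounded_linear_pred R s E (dual (dual E)).
Proof.
apply/bounded_linear_predP; split=> [a x y|].
  by apply: bopP => e; exact: bop_linear.
exists 1 => x; rewrite rnorm_bop mul1r opnorm_le ?rnorm_ge0// => e /=.
by rewrite rnorm_bop mulrC opnormP.
Qed.

Definition bidual_embedding (E : normedModType K) : bop E (dual (dual E)) :=
  BOp (bounded_linear_bidual E).

End operators.

(** * Pullbacks of Banach spaces *)

Section product.
Context {R : realType} {s : scalars}.
Local Notation K := (scalar_field R s).

Lemma rnorm_pair_le (U V : normedModType K) (p : U * V) (C : R) :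
  rnorm p.1 <= C -> rnorm p.2 <= C -> rnorm p <= C.
Proof.
rewrite -!rnorm_le_norm prod_normE => p1 p2.
by rewrite /Num.max; case: ifP.
Qed.

Lemma rnorm_fst_le (U V : normedModType K) (p : U * V) : rnorm p.1 <= rnorm p.
Proof.
by rewrite -rnorm_le_norm rnormE prod_normE /Num.max; case: ifP => // /ltW.
Qed.

Lemma rnorm_snd_le (U V : normedModType K) (p : U * V) : rnorm p.2 <= rnorm p.
Proof.
rewrite -rnorm_le_norm rnormE prod_normE /Num.max; case: ifP => // /negbT.
by rewrite real_ltNge ?normr_real// negbK.
Qed.

End product.

Section pullback.
Context {R : realType} {s : scalars}.
Local Notation K := (scalar_field R s).

Section definition.
Variables (U V W : normedModType K) (f : bop U W) (g : bop V W).

Definition pullback_pred : {pred U * V} := fun p => f p.1 == g p.2.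

(** The norm is inherited from the product, that is, the maximum of the norms
    of the two components. *)
Record pullback := Pullback {
  pullback_val :> U * V;
  pullback_in : pullback_val \in pullback_pred
}.

HB.instance Definition _ := [isSub for pullback_val].
HB.instance Definition _ := [Choice of pullback by <:].

Lemma pullback_submod : submod_closed pullback_pred.
Proof.
split; first by rewrite unfold_in !bop0.
move=> a p q; rewrite !unfold_in => /eqP pE /eqP qE.
by rewrite !bop_linear pE qE.
Qed.

HB.instance Definition _ := GRing.isSubmodClosed.Build K (U * V)%type
  pullback_pred pullback_submod.
HB.instance Definition _ := [SubChoice_isSubLmodule of pullback by <:].

Let norm (p : pullback) : K := `|val p|.

Let normD p q : norm (p + q) <= norm p + norm q.
Proof. exact: ler_normD. Qed.

Let normZ (a : K) p : norm (a *: p) = `|a| * norm p.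
Proof. exact: normrZ. Qed.

Let norm0_eq0 p : norm p = 0 -> p = 0.
Proof. by move/normr0_eq0 => p0; apply: val_inj. Qed.

HB.instance Definition _ :=
  Lmodule_isNormed.Build K pullback normD normZ norm0_eq0.

Lemma rnorm_pullback (p : pullback) : rnorm p = rnorm (val p).
Proof. by []. Qed.

Lemma pullbackE (p : pullback) : f p.1 = g p.2.
Proof. exact/eqP/(pullback_in p). Qed.

Lemma bounded_linear_pullback1 :
  (fun p : pullback => p.1) \in @bounded_linear_pred R s pullback U.
Proof.
apply/bounded_linear_predP; split=> [//|].
by exists 1 => p; rewrite mul1r rnorm_pullback rnorm_fst_le.
Qed.

Lemma bounded_linear_pullback2 :
  (fun p : pullback => p.2) \in @bounded_linear_pred R s pullback V.
Proof.
apply/bounded_linear_predP; split=> [//|].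
by exists 1 => p; rewrite mul1r rnorm_pullback rnorm_snd_le.
Qed.

Definition pullback1 : bop pullback U := BOp bounded_linear_pullback1.
Definition pullback2 : bop pullback V := BOp bounded_linear_pullback2.

End definition.

(** The pullback is closed in the product: both sides of the equation between
    the components are continuous. *)
Lemma pullback_complete (U V : completeNormedModType K) (W : normedModType K)
    (f : bop U W) (g : bop V W) (G : set_system (pullback f g)) :
  ProperFilter G -> cauchy G -> cvg G.
Proof.
move=> GF Gc.
have /cvg_ex[/= a Ga] := cvg_bop_cauchy (f := pullback1 f g) GF Gc.
have /cvg_ex[/= b Gb] := cvg_bop_cauchy (f := pullback2 f g) GF Gc.
have abP : (a, b) \in pullback_pred f g.
  rewrite unfold_in /=; apply/eqP.
  apply: (norm_cvg_unique (cvg_bop (f := f) _ Ga)).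
  rewrite (_ : (fun p => _) = (fun p : pullback f g => g p.2)).
    exact: (cvg_bop (f := g) _ Gb).
  by apply/funext => p; exact: pullbackE.
apply/cvg_ex; exists (Pullback abP); apply/cvgrPdist_le => e e0.
move/cvgrPdist_le : Ga => /(_ e e0); move/cvgrPdist_le : Gb => /(_ e e0).
apply: filterS2 => p; rewrite -(re_scalarK (ltW e0)) !rnorm_le_norm => pb pa.
by rewrite rnorm_pullback rnorm_pair_le.
Qed.

HB.instance Definition _ (U V : completeNormedModType K) (W : normedModType K)
    (f : bop U W) (g : bop V W) :=
  Uniform_isComplete.Build (pullback f g) (@pullback_complete U V W f g).

End pullback.

(** * The factorization of a two-Lipschitz map *)

Section factorization.
Context {R : realType} {s : scalars}.
Local Notation K := (scalar_field R s).
Variables X1 X2 : pointedMetricType R.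

Lemma transpose_comp (F E : normedModType K) (u : bop F E) (S : blip0 X1 X2 F) :
  transpose (blip0_comp u S) = bop_comp (transpose S) (adjoint u).
Proof. by apply: bopP => e; exact: blip0P. Qed.

Lemma opnorm_transpose (E : normedModType K) (T : blip0 X1 X2 E) :
  opnorm (transpose T) <= blip T.
Proof.
apply: opnorm_le (blip_ge0 T) _ => e; rewrite rnorm_blip0 rnorm_bop.
rewrite blip_le ?mulr_ge0 ?opnorm_ge0 ?blip_ge0// mulrC.
exact: two_lipschitz_bound_comp.
Qed.

Lemma bounded_linear_dirac (x : X1 * X2) :
  (fun f : blip0_dual X1 X2 => f x) \in
    @bounded_linear_pred R s (blip0_dual X1 X2) (scalar_space R s).
Proof.
apply/bounded_linear_predP; split=> [//|].
exists (mdist x.1 point * mdist x.2 point) => f.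
by rewrite rnorm_blip0; exact: blip0_le.
Qed.

Definition dirac (x : X1 * X2) : dual (blip0_dual X1 X2 : normedModType K) :=
  BOp (bounded_linear_dirac x).

(** The mixed differences of [dirac], tested on a function [f], are the mixed
    differences of [f], which [blip f] bounds. *)
Lemma dirac_bound : two_lipschitz_bound dirac 1.
Proof.
move=> x1 x1' x2 x2'; rewrite rnorm_bop mul1r.
apply: opnorm_le => [|f]; first by rewrite mulr_ge0 ?mdist_ge0.
by rewrite rnorm_blip0 mulrC mulrA; exact: blipP.
Qed.

Section one_map.
Variables (E : completeNormedModType K) (T : blip0 X1 X2 E).

(* Any positive number that is at least [blip T] would do; adding one keeps it
   invertible when [T] is zero. *)
Let c : R := blip T + 1.
Let a : K := of_real s c.

Let c_gt0 : 0 < c.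
Proof. by rewrite /c ltr_wpDl ?blip_ge0. Qed.

Let a_neq0 : a != 0.
Proof.
by rewrite gt_eqF// /a -(@of_real0 R s) of_real_lt.
Qed.

Let F : completeNormedModType K :=
  pullback (adjoint (transpose T)) (a *: bidual_embedding E).

(** Both components of the pair, tested on a functional [e] on [E], give
    [e (T x)]: the factor [a] of the bidual embedding cancels [a^-1]. *)
Lemma linearization_in (x : X1 * X2) :
  (dirac x, a^-1 *: T x) \in
    pullback_pred (adjoint (transpose T)) (a *: bidual_embedding E).
Proof.
rewrite unfold_in; apply/eqP/bopP => e /=.
change (e (T x) = a *: e (a^-1 *: T x)).
by rewrite bopZ scalerA mulfV// scale1r.
Qed.

(** The space [F] is an enlarged predual of [blip0_dual X1 X2]: membership in
    it prescribes the value of [e (u p)] as [p.1 (transpose T e)], and this is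
    what makes [adjoint u] factor through [transpose T]. *)
Lemma blip_factorization :
  exists (F : completeNormedModType K) (S : blip0 X1 X2 F) (u : bop F E)
      (r : bop (blip0_dual X1 X2) (dual F)),
    [/\ T = blip0_comp u S, adjoint u = bop_comp r (transpose T),
        blip S <= 1 & opnorm r <= 1].
Proof.
have [Tr Tl _] := blip0_prop T.
pose S0 (x : X1 * X2) : F := Pullback (linearization_in x).
have SP : two_lipschitz_bound S0 1.
  move=> x1 x1' x2 x2'; rewrite rnorm_pullback rnorm_pair_le//=.
    exact: dirac_bound.
  rewrite -!scalerBr -scalerDr.
  (* It remains to bound the mixed difference of [a^-1 T], where [c], the
     absolute value of [a], is at least [blip T]. *)
  set M := T _ - _ - _ + _.
  have aM : c * rnorm (a^-1 *: M) = rnorm M.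
    have -> : c = re_scalar `|a|.
      by rewrite ger0_norm ?of_realK// /a -(@of_real0 R s) of_real_le ltW.
    by rewrite -rnormZ scalerA mulfV// scale1r.
  rewrite -(ler_pM2l c_gt0) aM mul1r mulrA.
  rewrite (le_trans (blipP T x1 x1' x2 x2'))//.
  by rewrite !ler_wpM2r ?mdist_ge0// lerDl.
have Sin : S0 \in @two_lipschitz0_pred R s X1 X2 F.
  apply/two_lipschitz0_predP; split.
  - move=> x1; apply/val_inj/pair_equal_spec; split=> /=.
      by apply: bopP => f; have [/= fr _ _] := blip0_prop f; exact: fr.
    by rewrite Tr scaler0.
  - move=> x2; apply/val_inj/pair_equal_spec; split=> /=.
      by apply: bopP => f; have [/= _ fl _] := blip0_prop f; exact: fl.
    by rewrite Tl scaler0.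
  by exists 1.
pose p1 := pullback1 (adjoint (transpose T)) (a *: bidual_embedding E).
pose p2 := pullback2 (adjoint (transpose T)) (a *: bidual_embedding E).
exists F, (BLip0 Sin), (a *: p2), (bop_comp (adjoint p1) (bidual_embedding _)).
split.
- apply: blip0P => x.
  change (T x = a *: (a^-1 *: T x)).
  by rewrite scalerA mulfV// scale1r.
- apply: bopP => e; apply: bopP => p.
  (* This is the equation that defines [F], evaluated at [e]. *)
  change (e (a *: p.2) = p.1 (transpose T e)).
  have := congr1 (fun h : dual (dual E) => h e) (pullbackE p).
  change (p.1 (transpose T e) = a *: e p.2 -> e (a *: p.2) = p.1 (transpose T e)).
  by move=> ->; rewrite bopZ.
- exact: blip_le.
- apply: opnorm_le => // f; rewrite mul1r rnorm_bop.
  apply: opnorm_le (rnorm_ge0 _) _ => p.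
  change (rnorm (p.1 f) <= rnorm f * rnorm p).
  rewrite (le_trans (opnormP _ _))// mulrC ler_wpM2l ?rnorm_ge0//.
  by rewrite -rnorm_bop rnorm_pullback rnorm_fst_le.
Qed.

End one_map.
End factorization.

(** * Ideals *)

Section ideals.
Context {R : realType} {s : scalars}.
Local Notation K := (scalar_field R s).

Lemma ideal_compl (I : op_class R s) (E F G : completeNormedModType K)
    (r : bop F G) (u : bop E F) :
  operator_ideal I -> I E F u -> I E G (bop_comp r u).
Proof.
move=> hI Iu; have -> : bop_comp r u = bop_comp r (bop_comp u (bop_id E)).
  exact: bopP.
exact: ideal_comp.
Qed.

Lemma ideal_norm_compl (I : op_class R s) (N : op_gauge R s)
    (E F G : completeNormedModType K) (r : bop F G) (u : bop E F) :
  normed_operator_ideal I N -> I E F u ->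
  N E G (bop_comp r u) <= opnorm r * N E F u.
Proof.
move=> hN Iu; have -> : bop_comp r u = bop_comp r (bop_comp u (bop_id E)).
  exact: bopP.
rewrite (le_trans (ideal_norm_comp hN (bop_id E) r Iu))//.
rewrite ler_piMr ?opnorm_id// mulr_ge0 ?opnorm_ge0//.
exact: ideal_norm_ge0 hN _ _ _ Iu.
Qed.

End ideals.

Theorem theorem4p3 (R : realType) (s : scalars) (I : op_class R s)
    (hI : operator_ideal I) :
  (forall (X1 X2 : pointedMetricType R)
      (E : completeNormedModType (scalar_field R s)),
    blip_dual X1 X2 E I = blip_comp X1 X2 E (dual_ideal I)) /\
  (forall N : op_gauge R s, normed_operator_ideal I N ->
    forall (X1 X2 : pointedMetricType R)
      (E : completeNormedModType (scalar_field R s)) (T : blip0 X1 X2 E),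
    blip_dual X1 X2 E I T ->
    blip_dual_norm N T = blip_comp_norm (dual_ideal I) (dual_ideal_norm N) T).
Proof.
split=> [X1 X2 E|N hN X1 X2 E T IT].
  apply/seteqP; split=> T.
    move=> IT; have [F [S [u [r [TE uE _ _]]]]] := blip_factorization T.
    exists F, S, u; split=> //.
    by rewrite /dual_ideal uE; exact: ideal_compl.
  move=> [F [S [u [Iu ->]]]].
  by rewrite /blip_dual /= transpose_comp; exact: ideal_compl.
have [F [S [u [r [TE uE S1 r1]]]]] := blip_factorization T.
have Iu : dual_ideal I u by rewrite /dual_ideal uE; exact: ideal_compl.
(* Every factorization bounds the norm of the transpose from above, and the one
   above attains it. *)
have lb : lbound [set c | exists (F : completeNormedModType _)
    (S : blip0 X1 X2 F) (u : bop F E), [/\ dual_ideal I u,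
      T = blip0_comp u S & c = dual_ideal_norm N u * blip S]]
    (blip_dual_norm N T).
  move=> _ [G [S' [v [Iv -> ->]]]].
  rewrite /blip_dual_norm transpose_comp.
  rewrite (le_trans (ideal_norm_compl _ hN Iv))// mulrC.
  by rewrite ler_wpM2l ?opnorm_transpose// (ideal_norm_ge0 hN Iv).
apply/le_anti/andP; split.
  apply: lb_le_inf lb.
  by exists (dual_ideal_norm N u * blip S), F, S, u.
have Nu : dual_ideal_norm N u * blip S <= blip_dual_norm N T.
  rewrite (le_trans (ler_piMr (ideal_norm_ge0 hN Iu) S1))//.
  rewrite /dual_ideal_norm uE (le_trans (ideal_norm_compl _ hN IT))//.
  by rewrite ler_piMl// (ideal_norm_ge0 hN IT).
apply: le_trans Nu; apply: ge_inf; first by exists (blip_dual_norm N T).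
by exists F, S, u.
Qed.
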